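(* Let $\hat H=\sum_{k}E_k|E_k\rangle\langle E_k|$ be a Hamiltonian with a nondegenerate ground state of energy $E_{\rm GS}=E_0$ and spectral gap $\Delta=E_1-E_{\rm GS}>0$. Let $|\psi(\tau)\rangle$ be a normalized trajectory of the exact augmented imaginary-time evolution (AITE) flow (defined in the context), and let $\varepsilon(\tau)=\langle\psi(\tau)|\hat H|\psi(\tau)\rangle-E_{\rm GS}$ be its energy error, which along the flow satisfies $\dot\varepsilon=-\sqrt{4\mu_2^2+\mu_3^2/\mu_2}$, where $\mu_n(\tau)$ is the $n$th central energy moment of $|\psi(\tau)\rangle$. Then, for all $\varepsilon\in(0,\Delta/4]$, the energy error obeys $$\dot\varepsilon\;\le\;-\frac{5}{16}\,\Delta^{3/2}\sqrt{\varepsilon}\,.$$ Consequently, once a trajectory satisfies $\varepsilon(\tau_1)=\varepsilon_1\le\Delta/4$, it reaches $\varepsilon=0$ exactly, at a time $$\tau^*\;\le\;\tau_1+\frac{32}{5}\,\frac1\Delta\sqrt{\frac{\varepsilon_1}{\Delta}}\;\le\;\tau_1+\frac{16}{5\Delta}\,.$$ Moreover, any trajectory with $\varepsilon(0)=\varepsilon_0<\Delta$ enters this basin (the region $\varepsilon\le\Delta/4$) in the finite time $$\tau_1\;\le\;\frac{1}{2\Delta}\ln\!\left(\frac{3\varepsilon_0}{\Delta-\varepsilon_0}\right).$$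
   Context: Here $E_0=E_{\rm GS}$ is the lowest eigenvalue of $\hat H$, and $E_1$ is the next lowest, so $E_k-E_{\rm GS}\ge\Delta$ for all $k\ge1$. For a normalized state $|\psi\rangle$, write $\bar H=\hat H-\langle\psi|\hat H|\psi\rangle$ and $\mu_n=\langle\psi|\bar H^n|\psi\rangle$ for the $n$th central energy moment. When $\mu_2>0$, let $\hat\rho=|\psi\rangle\langle\psi|$, $\hat\chi=-[\hat H,[\hat H,\hat\rho]]$, and $|v_H\rangle=\bar H|\psi\rangle/\sqrt{\mu_2}$ (a unit vector orthogonal to $|\psi\rangle$). The compression of $\hat\chi$ to the span of $|\psi\rangle$ and $|v_H\rangle$ is, in this basis, $-2\mu_2\begin{pmatrix}1&\kappa/2\\ \kappa/2&-1\end{pmatrix}$ with skewness $\kappa=\mu_3/\mu_2^{3/2}$. Let $|\lambda_-\rangle$ be its normalized eigenvector for the lowest eigenvalue $-2\mu_2\sqrt{1+\kappa^2/4}$, that is, $|\lambda_-\rangle=\cos\phi\,|\psi\rangle+\sin\phi\,|v_H\rangle$ with $\tan(2\phi)=\kappa/2$, and let $\hat\rho^{\mathrm A}=|\lambda_-\rangle\langle\lambda_-|$. All these quantities depend on $\tau$ through $|\psi(\tau)\rangle$. The AITE flow is the norm-preserving equation $\partial_\tau|\psi(\tau)\rangle=-[\hat H,\hat\rho^{\mathrm A}(\tau)]\,|\psi(\tau)\rangle$; after reaching $\varepsilon=0$ the trajectory is continued by the ground state, with $\varepsilon\equiv0$.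
   Formalization: The last bound on τ₁ is replaced by its maximum with 0, since for ε₀ < Δ/4 the printed logarithm is negative (undefined at ε₀ = 0) although the trajectory starts in the basin at τ = 0; the Hilbert space is read as finite-dimensional. *)

(* Defs.v *)
From HB Require Import structures.
From mathcomp Require Import all_boot all_order all_algebra.
From mathcomp Require Import all_classical all_reals all_analysis.
From mathcomp Require Export complex.
From mathcomp Require Import ring lra.
Set Implicit Arguments.
Unset Strict Implicit.
Unset Printing Implicit Defensive.
Import Order.TTheory GRing.Theory Num.Theory.
Import numFieldNormedType.Exports.

Local Open Scope classical_set_scope.
Local Open Scope ring_scope.
Local Open Scope complex_scope.
Local Open Scope sesquilinear_scope.

(* MathComp-Analysis puts the norm topology on abstract numFieldTypes only;
   these copies make it (hence the topology of column vectors) visible on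
   R[i]. *)
HB.instance Definition _ (R : rcfType) := GRing.ComAlgebra.copy R[i] (R[i]^o).
HB.instance Definition _ (R : rcfType) := Vector.copy R[i] (R[i]^o).
HB.instance Definition _ (R : rcfType) :=
  NormedModule.copy R[i] ((R[i] : numFieldType)^o).

Section Kets.
Context {R : realType} {m : nat}.
Implicit Types (A B : 'M[R[i]]_m.+1) (u v : 'cV[R[i]]_m.+1).

(* Conjugate-linear in the first argument, as in <u|v>. *)
Definition braket u v : R[i] := (u ^t* *m v) 0 0.

Definition projector u : 'M[R[i]]_m.+1 := u *m u ^t*.

Definition commutator A B : 'M[R[i]]_m.+1 := A *m B - B *m A.

(* <u|A|u>; the real part loses nothing, as it is used for Hermitian A only. *)
Definition expect A u : R := complex.Re (braket u (A *m u)).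

Definition orthonormal_kets (e : 'I_m.+1 -> 'cV[R[i]]_m.+1) : Prop :=
  forall j k, braket (e j) (e k) = (j == k)%:R.

Definition spectral_sum (E : 'I_m.+1 -> R) (e : 'I_m.+1 -> 'cV[R[i]]_m.+1) :
    'M[R[i]]_m.+1 :=
  \sum_k (E k)%:C *: projector (e k).

End Kets.

Section AITE.
Context {R : realType} {m : nat}.
Variable H : 'M[R[i]]_m.+1.
Implicit Types u : 'cV[R[i]]_m.+1.

Definition Hbar u : 'M[R[i]]_m.+1 := H - ((expect H u)%:C)%:M.

Definition moment (k : nat) u : R := expect (Hbar u ^+ k) u.

(* skewness, v_H and what is built from them are meaningful for
   0 < moment 2 u only. *)
Definition skewness u : R := moment 3 u / (moment 2 u `^ (3 / 2)).

Definition v_H u : 'cV[R[i]]_m.+1 :=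
  ((Num.sqrt (moment 2 u))^-1)%:C *: (Hbar u *m u).

(* tan (2 phi) = kappa / 2 fixes phi modulo pi / 2 only; the branch
   -pi/4 < phi < pi/4 is the one that gives the lowest eigenvalue of the
   compression of -[H, [H, |u><u|]] to the span of u and v_H u
   (see lambda_minus_eigen). *)
Definition aite_angle u : R := atan (skewness u / 2) / 2.

Definition lambda_minus u : 'cV[R[i]]_m.+1 :=
  (cos (aite_angle u))%:C *: u + (sin (aite_angle u))%:C *: v_H u.

Definition compression u : 'M[R]_(1 + 1) :=
  (- 2 * moment 2 u) *:
  block_mx (1%:M : 'M[R]_1) (skewness u / 2)%:M (skewness u / 2)%:M (- 1%:M).

Lemma lambda_minus_eigen u :
  let c : 'cV[R]_(1 + 1) :=
    col_mx (cos (aite_angle u))%:M (sin (aite_angle u))%:M in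
  compression u *m c =
    (- 2 * moment 2 u * Num.sqrt (1 + skewness u ^+ 2 / 4)) *: c.
Proof.
move=> c; rewrite /compression /c -scalemxAl mul_block_col.
rewrite -[in RHS]scalerA; congr (_ *: _); rewrite scale_col_mx.
rewrite !mulNmx !mul1mx -!scalar_mxM !scale_scalar_mx -!raddfN -!raddfD /=.
set k := skewness u / 2; set p := aite_angle u.
have pE : p = atan k - p by rewrite /p /aite_angle -/k; field.
have -> : 1 + skewness u ^+ 2 / 4 = 1 + k ^+ 2 by rewrite /k; field.
have ct : cos (atan k) = (Num.sqrt (1 + k ^+ 2))^-1 by rewrite cos_atan.
have c0 : cos (atan k) != 0 by rewrite ct invr_eq0 sqrtr_eq0 -ltNge; nra.
have -> : Num.sqrt (1 + k ^+ 2) = (cos (atan k))^-1 by rewrite ct invrK.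
have kE : k = sin (atan k) / cos (atan k) by rewrite -[LHS]atanK.
have ec : cos p = cos (atan k) * cos p + sin (atan k) * sin p.
  by rewrite [in LHS]pE cosB.
have es : sin p = sin (atan k) * cos p - cos (atan k) * sin p.
  by rewrite [in LHS]pE sinB.
congr (col_mx _%:M _%:M).
  rewrite [in RHS]ec {1}kE; field; exact: c0.
rewrite [in RHS]es {1}kE; field; exact: c0.
Qed.

Definition rhoA u : 'M[R[i]]_m.+1 := projector (lambda_minus u).

Definition aite_field u : 'cV[R[i]]_m.+1 := - (commutator H (rhoA u) *m u).

(* Derivatives relative to the time domain [0, +oo[: two-sided at t > 0,
   one-sided at t = 0. *)
Definition ket_derivative (psi : R -> 'cV[R[i]]_m.+1) (t : R)
    (v : 'cV[R[i]]_m.+1) : Prop :=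
  (fun s => ((s - t)^-1)%:C *: (psi s - psi t)) @ within `[0, +oo[ t^' --> v.

Definition time_derivative (f : R -> R) (t d : R) : Prop :=
  (fun s => (s - t)^-1 * (f s - f t)) @ within `[0, +oo[ t^' --> d.

(* The flow is imposed wherever its field is defined. At an instant where it is
   not (psi t is an eigenvector of H) continuity is required, and for the
   ground energy EGS psi remains in the ground eigenspace from then on.
   In finite dimension a maximal solution converges when its lifetime is
   finite, so asking psi on the whole of [0, +oo[ excludes no solution. *)
Record aite_trajectory (EGS : R) (psi : R -> 'cV[R[i]]_m.+1) : Prop := {
  aite_normalized : forall t, 0 <= t -> braket (psi t) (psi t) = 1;
  aite_continuous : {within `[0, +oo[, continuous psi};
  aite_flow : forall t, 0 <= t -> 0 < moment 2 (psi t) ->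
    ket_derivative psi t (aite_field (psi t));
  aite_ground : forall t s, 0 <= t -> t <= s -> expect H (psi t) = EGS ->
    H *m psi s = EGS%:C *: psi s
}.

End AITE.

(* Main.v *)
(* In the eigenbasis e of H, the vector lambda_minus is obtained from psi by
   multiplying each amplitude z_k = <e_k|psi> by a real factor, so the flow reads
   z_k' = - g_k z_k with g_k real, and summing E_k (|z_k|^2)' gives the formula for
   eps' in terms of the moments of the distribution p_k = |z_k|^2.

   Let a = eps, and let m_j be the moments of E_k - E_0 under p. The spectral gap
   gives m_2 >= Delta a and Cauchy-Schwarz gives m_3 a >= m_2^2; with w = m_2 / a
   these yield eps'^2 >= a (w - a) w^2 >= a (Delta - a) Delta^2 as soon as
   a <= Delta / 2, which is stronger than the basin estimate. There sqrt eps
   decreases at least linearly until it vanishes. Outside the basin,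
   eps' <= - 2 mu_2 <= - 2 eps (Delta - eps) makes ln (eps / (Delta - eps))
   decrease at rate at least 2 Delta. *)
Require Import Defs.
From mathcomp Require Import all_boot all_order all_algebra.
From mathcomp Require Import all_classical all_reals all_analysis.
From mathcomp Require Import ring lra.
Set Implicit Arguments.
Unset Strict Implicit.
Unset Printing Implicit Defensive.
Import Order.TTheory GRing.Theory Num.Theory.
Import numFieldNormedType.Exports.
Local Open Scope classical_set_scope.
Local Open Scope ring_scope.
Local Open Scope complex_scope.
Local Open Scope sesquilinear_scope.

(** The squared modulus is taken in [R] rather than in [R[i]], so that the populations of the
    eigenstates form a real distribution. *)
Definition sqnormc (R : realType) (z : R[i]) : R :=
  complex.Re z ^+ 2 + complex.Im z ^+ 2.

(** * Amplitudes and moments in an orthonormal eigenbasis *)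

Section Spectral.
Context (R : realType) (m : nat) (e : 'I_m.+1 -> 'cV[R[i]]_m.+1).
Hypothesis eO : orthonormal_kets e.
Implicit Types (u v : 'cV[R[i]]_m.+1) (f g : 'I_m.+1 -> R).

Lemma braket_conj u v : braket u v = Num.conj (braket v u).
Proof.
rewrite /braket !mxE rmorph_sum; apply: eq_bigr => j _ /=.
by rewrite !mxE rmorphM /= conjCK mulrC.
Qed.

Lemma mul_projector u v : projector u *m v = braket u v *: u.
Proof.
apply/matrixP => i j; rewrite /projector -mulmxA !mxE big_ord1 mulrC.
by rewrite (ord1 j).
Qed.

Lemma braketDr u v w : braket u (v + w) = braket u v + braket u w.
Proof. by rewrite /braket mulmxDr mxE. Qed.

Lemma braketZr u (a : R[i]) v : braket u (a *: v) = a * braket u v.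
Proof. by rewrite /braket -scalemxAr mxE. Qed.

Lemma braketNr u v : braket u (- v) = - braket u v.
Proof. by rewrite /braket mulmxN mxE. Qed.

Lemma braket_sumr u (F : 'I_m.+1 -> 'cV[R[i]]_m.+1) :
  braket u (\sum_k F k) = \sum_k braket u (F k).
Proof. by rewrite /braket mulmx_sumr summxE. Qed.

(** Orthonormality says that the matrix [U] with columns [e k] has [U ^t*] as a left inverse. Since
    [U] is square, this is also a right inverse, which is the completeness relation. *)
Lemma sum_projector : \sum_k projector (e k) = 1%:M.
Proof.
pose U : 'M[R[i]]_m.+1 := \matrix_(i, j) e j i 0.
have UU : U ^t* *m U = 1%:M.
  apply/matrixP => i j; rewrite [RHS]mxE -eO /braket !mxE.
  by apply: eq_bigr => k _; rewrite !mxE.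
rewrite -(mulmx1C UU); apply/matrixP => i j; rewrite summxE mxE.
by apply: eq_bigr => k _; rewrite /projector !mxE big_ord1 !mxE.
Qed.

Lemma spectral_sum_mul f u :
  spectral_sum f e *m u = \sum_k ((f k)%:C * braket (e k) u) *: e k.
Proof.
rewrite /spectral_sum mulmx_suml; apply: eq_bigr => k _.
by rewrite -scalemxAl mul_projector scalerA.
Qed.

Lemma ket_decomposition u : u = \sum_k braket (e k) u *: e k.
Proof.
rewrite -[LHS]mul1mx -sum_projector mulmx_suml.
by apply: eq_bigr => k _; rewrite mul_projector.
Qed.

Lemma braket_spectral_sum f u k :
  braket (e k) (spectral_sum f e *m u) = (f k)%:C * braket (e k) u.
Proof.
rewrite spectral_sum_mul braket_sumr (bigD1 k) //= big1 => [|j jk].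
  by rewrite addr0 braketZr eO eqxx mulr1.
by rewrite braketZr eO eq_sym (negPf jk) mulr0.
Qed.

Lemma braket_coord u v :
  braket u v = \sum_k Num.conj (braket (e k) u) * braket (e k) v.
Proof.
rewrite {1}(ket_decomposition v) braket_sumr; apply: eq_bigr => k _.
by rewrite braketZr mulrC -braket_conj.
Qed.

Lemma conj_RC (a : R) : Num.conj a%:C = a%:C.
Proof. exact: conjc_real. Qed.

Lemma conjM_sqnormc (z : R[i]) : Num.conj z * z = (sqnormc z)%:C.
Proof.
by case: z => a b; rewrite /sqnormc; simpc; congr (_ +i* _) => /=; ring.
Qed.

Lemma braket_spectral_diag f u :
  braket u (spectral_sum f e *m u) =
    (\sum_k f k * sqnormc (braket (e k) u))%:C.
Proof.
rewrite braket_coord raddf_sum; apply: eq_bigr => k _.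
by rewrite braket_spectral_sum mulrCA conjM_sqnormc /= rmorphM.
Qed.

Lemma expect_spectral f u :
  expect (spectral_sum f e) u = \sum_k f k * sqnormc (braket (e k) u).
Proof. by rewrite /expect braket_spectral_diag. Qed.

Lemma braket_sqnorm u : braket u u = (\sum_k sqnormc (braket (e k) u))%:C.
Proof.
rewrite braket_coord raddf_sum; apply: eq_bigr => k _.
by rewrite conjM_sqnormc.
Qed.

Lemma Hbar_spectral f u :
  Hbar (spectral_sum f e) u =
  spectral_sum (fun k => f k - expect (spectral_sum f e) u) e.
Proof.
set a := expect _ _; rewrite /Hbar -/a -scalemx1 -sum_projector scaler_sumr.
rewrite /spectral_sum -sumrB; apply: eq_bigr => k _.
by rewrite -scalerBl raddfB.
Qed.

Lemma braket_spectral_exp f k j u :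
  braket (e k) (spectral_sum f e ^+ j *m u) = (f k ^+ j)%:C * braket (e k) u.
Proof.
elim: j u => [|j IH] u; first by rewrite !expr0 mul1mx mul1r.
by rewrite exprSr -mulmxA IH braket_spectral_sum mulrA exprSr rmorphM.
Qed.

Lemma moment_spectral f j u :
  moment (spectral_sum f e) j u =
  \sum_k (f k - expect (spectral_sum f e) u) ^+ j * sqnormc (braket (e k) u).
Proof.
rewrite /moment Hbar_spectral.
set h := fun k => _ - _.
rewrite /expect braket_coord raddf_sum; apply: eq_bigr => k _.
by rewrite braket_spectral_exp mulrCA conjM_sqnormc -rmorphM.
Qed.

(** Write lam for [lambda_minus H u]. The field is <lam|Hu> lam - <lam|u> H lam, and the amplitude
    of lam on [e k] is [c + s * r * h] times that of [u]. The two overlaps follow from the centred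
    moments of orders 0, 1 and 2. *)
Lemma braket_aite_field f u k : let H := spectral_sum f e in
  let r := (Num.sqrt (moment H 2 u))^-1 in
  let c := cos (aite_angle H u) in let s := sin (aite_angle H u) in
  let h := f k - expect H u in
  braket u u = 1 ->
  braket (e k) (aite_field H u) =
  (- ((c + s * r * h) * (c * h - s * r * moment H 2 u)))%:C * braket (e k) u.
Proof.
move=> H r c s h u1.
pose hh j := f j - expect H u.
have lamk j : braket (e j) (lambda_minus H u) =
    (c + s * r * hh j)%:C * braket (e j) u.
  rewrite /lambda_minus /v_H Hbar_spectral braketDr !braketZr.
  rewrite braket_spectral_sum -/H -/c -/s -/r -/(hh j).
  by rewrite !(rmorphD, rmorphM) /=; ring.
pose P j := sqnormc (braket (e j) u).
have M0 : \sum_j P j = 1.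
  by apply: (@complexI R); rewrite -braket_sqnorm u1.
have M1 : \sum_j hh j * P j = 0.
  under eq_bigr do rewrite mulrBl.
  by rewrite sumrB -mulr_sumr M0 mulr1 -expect_spectral subrr.
have M2 : moment H 2 u = \sum_j hh j ^+ 2 * P j by exact: moment_spectral.
(* The first centred moment vanishes, so the [v_H] component contributes nothing to this overlap. *)
have lu : braket (lambda_minus H u) u = c%:C.
  rewrite braket_coord.
  under eq_bigr => j _ do
    rewrite lamk rmorphM /= conj_RC -mulrA conjM_sqnormc -rmorphM.
  rewrite -raddf_sum; congr (_%:C).
  transitivity (c * \sum_j P j + s * r * \sum_j hh j * P j).
    rewrite !mulr_sumr -big_split; apply: eq_bigr => j _ /=.
    by rewrite -/(P j); ring.
  by rewrite M0 M1; ring.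
have lHu : braket (lambda_minus H u) (H *m u) =
    (expect H u * c + s * r * moment H 2 u)%:C.
  rewrite braket_coord.
  under eq_bigr => j _ do
    rewrite lamk braket_spectral_sum rmorphM /= conj_RC mulrACA conjM_sqnormc
      -!rmorphM.
  rewrite -raddf_sum; congr (_%:C).
  transitivity (expect H u * (c * \sum_j P j)
    + (c + expect H u * s * r) * (\sum_j hh j * P j)
    + s * r * \sum_j hh j ^+ 2 * P j).
    rewrite !mulr_sumr -!big_split; apply: eq_bigr => j _ /=.
    by rewrite -/(P j) /hh; ring.
  by rewrite M0 M1 -M2; ring.
rewrite /aite_field /commutator /rhoA mulmxBl -(mulmxA H) -(mulmxA (projector _)) !mul_projector.
rewrite lu lHu -scalemxAr opprB braketDr braketNr !braketZr.
rewrite braket_spectral_sum lamk.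
rewrite /hh -/h /h !(rmorphM, rmorphN, rmorphD, rmorphB) /=.
ring.
Qed.
End Spectral.

(** * Limits and derivatives of amplitudes *)

(** Conjugate-linearity turns the factor i into -i. Limits and derivatives then need to be treated
    for real parts only. *)
Lemma Im_braket (R : realType) (m : nat) (w u : 'cV[R[i]]_m.+1) :
  complex.Im (braket w u) = complex.Re (braket ('i%C *: w) u).
Proof.
rewrite [in RHS]braket_conj braketZr rmorphM /= -braket_conj.
by case: (braket w u) => a b; simpc; rewrite /=; ring.
Qed.

Lemma cvg_Re (R : realType) (T : Type) (F : set_system T)
    (f : T -> R[i]) (z : R[i]) :
  Filter F -> f @ F --> z -> (fun x => complex.Re (f x)) @ F --> complex.Re z.
Proof.
move=> FF /cvgrPdist_lt fz; apply/cvgrPdist_lt => e e0.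
have {}e0 : 0 < e%:C by rewrite ltcR.
apply: filterS (fz _ e0) => x.
rewrite -ltcR; apply: le_lt_trans.
by rewrite -raddfB; exact: normc_ge_Re.
Qed.

Lemma cvg_braket (R : realType) (m : nat) (T : Type) (F : set_system T)
    (w : 'cV[R[i]]_m.+1) (f : T -> 'cV[R[i]]_m.+1) v :
  Filter F -> f @ F --> v -> (fun x => braket w (f x)) @ F --> braket w v.
Proof.
move=> FF fv; rewrite /braket.
have E u : (w ^t* *m u) 0 0 = \sum_j (w ^t*) 0 j * u j 0 by rewrite mxE.
under eq_fun do rewrite E.
rewrite E.
apply: (@cvg_big _ _ +%R 0 xpredT add_continuous) => j _.
apply: (@cvgMl_tmp (R[i] : numFieldType) _ F FF
  (fun x => f x j 0 : R[i]^o)).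
exact: (@cvg_comp _ _ _ f (fun u : 'cV[R[i]]_m.+1 => u j 0) F (nbhs v)
  (nbhs (v j 0)) fv (@coord_continuous (R[i] : numFieldType) _ _ j 0 v)).
Qed.

Lemma ket_derivative_Re (R : realType) (m : nat) (w : 'cV[R[i]]_m.+1) psi t v :
  ket_derivative psi t v ->
  time_derivative (fun s => complex.Re (braket w (psi s))) t
    (complex.Re (braket w v)).
Proof.
move=> dpsi.
rewrite /time_derivative.
rewrite (_ : (fun s => _) = fun s => complex.Re
    (braket w ((s - t)^-1%:C *: (psi s - psi t)))).
  by apply: cvg_Re; apply: cvg_braket.
apply/funext => s.
rewrite /braket -scalemxAr mulmxBr !mxE -raddfB.
have ReZ (a : R) (z : R[i]) : complex.Re (a%:C * z) = a * complex.Re z.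
  by case: z => x y /=; rewrite mul0r subr0.
by rewrite ReZ.
Qed.

(** * Calculus of derivatives relative to the half-line of times *)

Section TimeDerivative.
Context (R : realType).
Implicit Types (f g : R -> R) (t d : R).

Lemma cvg_near_eq (T : Type) (F : set_system T) (f g : T -> R) (l : R) :
  Filter F -> f @ F --> l -> (\forall x \near F, f x = g x) -> g @ F --> l.
Proof.
move=> FF fl fg P /fl; rewrite /= !nbhs_simpl /=.
by apply: filterS2 fg => x /= ->.
Qed.

Lemma time_derivative_cvg f t d : time_derivative f t d ->
  f s @[s --> within `[0, +oo[ t^'] --> f t.
Proof.
move=> fd.
have st : (s - t) @[s --> within `[0, +oo[ t^'] --> (0 : R).
  rewrite -(subrr t); apply: cvgB; last exact: cvg_cst.
  by apply: cvg_within_filter; apply: cvg_within_filter; exact: cvg_id.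
rewrite -[X in _ --> X]addr0 -[X in f t + X](mulr0 d).
apply: cvg_near_eq; first exact: (cvgD (cvg_cst (f t)) (cvgM fd st)).
have : \forall s \near within `[0, +oo[ t^', s != t.
  by rewrite near_withinE; apply: filterS (nbhs_dnbhs_neq t) => s.
apply: filterS => s /=; rewrite -subr_eq0 => stn.
rewrite -[LHS]/(f t + (s - t)^-1 * (f s - f t) * (s - t)) mulrAC mulVf// mul1r.
by rewrite addrC subrK.
Qed.

Lemma time_derivative_sqr f t d : time_derivative f t d ->
  time_derivative (fun s => f s ^+ 2) t (2 * f t * d).
Proof.
move=> fd.
have -> : 2 * f t * d = d * (f t + f t) by ring.
apply: cvg_near_eq; first exact: (cvgM fd (cvgD (time_derivative_cvg fd) (cvg_cst (f t)))).
apply: nearW => s /=.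
by rewrite -[LHS]/((s - t)^-1 * (f s - f t) * (f s + f t)); ring.
Qed.

Lemma time_derivativeD f g t d e : time_derivative f t d ->
  time_derivative g t e -> time_derivative (fun s => f s + g s) t (d + e).
Proof.
move=> fd ge; apply: cvg_near_eq; first exact: (cvgD fd ge).
apply: nearW => s /=.
by rewrite -[LHS]/(_ + _); ring.
Qed.

Lemma time_derivativeZ f t d c : time_derivative f t d ->
  time_derivative (fun s => c * f s) t (c * d).
Proof.
move=> fd; apply: cvg_near_eq; first exact: (cvgM (cvg_cst c) fd).
apply: nearW => s /=.
by ring.
Qed.

Lemma time_derivative_cst c t : time_derivative (fun=> c) t 0.
Proof.
rewrite /time_derivative subrr; under eq_fun do rewrite mulr0.
exact: cvg_cst.
Qed.

Lemma time_derivative_sum (I : Type) (r : seq I) (F : I -> R -> R) (d : I -> R) t :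
  (forall k, time_derivative (F k) t (d k)) ->
  time_derivative (fun s => \sum_(k <- r) F k s) t (\sum_(k <- r) d k).
Proof.
move=> Fd; elim: r => [|k r IH].
  rewrite big_nil; under eq_fun do rewrite big_nil.
  exact: time_derivative_cst.
rewrite big_cons; under eq_fun do rewrite big_cons.
exact: time_derivativeD.
Qed.

(** A neighbourhood of a positive instant lies in the half-line, so the restriction of the domain
    disappears there. This gives access to the mean value theorem. *)
Lemma time_derivative_is_derive f t d : 0 < t -> time_derivative f t d ->
  is_derive t 1 f d.
Proof.
move=> t0 fd.
have fd' : (s - t)^-1 * (f s - f t) @[s --> t^'] --> d.
  move=> P /fd fP.
  have {}fP : t^' [set s | `[0, +oo[%classic s -> P ((s - t)^-1 * (f s - f t))] := fP.
  have : \forall s \near t, 0 <= s.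
    by apply: filterS (lt_nbhsr t0) => s /ltW.
  move=> /nbhs_dnbhs /filterS2; apply; last exact: fP.
  by move=> s s0; apply; rewrite /= in_itv /= s0.
have H : h^-1 *: (f (h *: 1 + t) - f t) @[h --> 0^'] --> d.
  apply/cvgrPdist_lt => e e0; move/cvgrPdist_lt: fd' => /(_ e e0).
  case=> r /= r0 br; exists r => //= h /= hr hn0.
  have := br (h + t); rewrite /= -[h *: 1]/(h * 1) mulr1 addrK; apply.
    by move: hr; rewrite /ball /= opprD addrCA subrr addr0 sub0r.
  by rewrite -subr_eq0 addrK.
apply: DeriveDef; first exact: (cvgP d).
by apply: cvg_lim.
Qed.

Lemma time_derivative_right f t d : 0 <= t -> d < 0 -> time_derivative f t d ->
  \forall s \near t^'+, f s <= f t.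
Proof.
move=> t0 d0 /cvgr_lt /(_ _ d0).
rewrite !near_withinE; apply: filterS => s Hs ts.
have /Hs : s != t by rewrite gt_eqF.
rewrite /= in_itv /= andbT => /(_ (ltW (le_lt_trans t0 ts))).
by rewrite pmulr_rlt0 ?invr_gt0 ?subr_gt0// subr_lt0 => /ltW.
Qed.

(* Just after the first instant r at which f <= c would fail, continuity (if
   f r < c) or the hypothesis (if f r = c) still gives f <= c. *)
Lemma le_cst_forward f a b c : {within `[a, b], continuous f} -> f a <= c ->
  (forall t, a <= t -> t < b -> f t = c -> \forall s \near t^'+, f s <= c) ->
  forall t, a <= t <= b -> f t <= c.
Proof.
move=> fcont fac fright u /andP[au ub]; rewrite leNgt; apply/negP => cu.
have ltab : a < b.
  apply: lt_le_trans ub; rewrite lt_neqAle au andbT.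
  by apply: contraTneq cu => <-; rewrite -leNgt.
have [fin fa fb] := (continuous_within_itvP f ltab).1 fcont.
pose A := [set t | a <= t <= u /\ c < f t].
have Au : A u by rewrite /A /= au lexx.
have lbA : has_lbound A by exists a => t [/andP[]].
have infA : has_inf A by split; [exists u|].
set r := inf A.
have ar : a <= r by apply: lb_le_inf; [exists u|move=> t [/andP[]]].
have ru : r <= u by apply: ge_inf.
have below s : a <= s -> s < r -> f s <= c.
  move=> as_ sr; rewrite leNgt; apply/negP => cs.
  suff : r <= s by rewrite leNgt sr.
  by apply: ge_inf => //; split=> //; rewrite as_ (ltW (lt_le_trans sr ru)).
have frc : f r <= c.
  have [<-//|nar] := eqVneq a r.
  have {nar}ar' : a < r by rewrite lt_neqAle nar.
  rewrite leNgt; apply/negP => cr.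
  have fl : f @ r^'- --> f r.
    have [rb|br] := ltP r b.
      by apply: cvg_at_left_filter; apply: fin; rewrite in_itv /= ar' rb.
    by have -> : r = b by apply/le_anti; rewrite br (le_trans ru ub).
  have /cvgr_gt/(_ _ cr) cs := fl.
  near r^'- => s.
  suff : f s <= c by rewrite leNgt => /negP; apply; near: s.
  by apply: below; [apply: ltW; near: s; exact: nbhs_left_gt|near: s; exact: nbhs_left_lt].
have ltru : r < u.
  by rewrite lt_neqAle ru andbT; apply: contraTneq cu => <-; rewrite -leNgt.
have ltrb := lt_le_trans ltru ub.
have right_le : \forall s \near r^'+, f s <= c.
  have [/(fright r ar ltrb)//|nc] := eqVneq (f r) c.
  have frc' : f r < c by rewrite lt_neqAle nc.
  have fr : f @ r^'+ --> f r.
    have [->//|nar] := eqVneq r a.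
    apply: cvg_at_right_filter; apply: fin.
    by rewrite in_itv /= ltrb lt_neqAle eq_sym nar ar.
  by move/cvgr_lt: fr => /(_ _ frc'); apply: filterS => s /ltW.
case: right_le => d /= d0 dP.
(* The infimum is approached by instants with [c < f t]. One of them falls within distance [d] to
   the right of [r], where [f <= c] is already known. *)
have [t [/andP[at_ tu] ct] trd] := inf_adherent d0 infA.
have rt : r <= t by apply: ge_inf => //; split=> //; rewrite at_ tu.
move: ct; rewrite ltNge => /negP; apply.
have [<-//|nrt] := eqVneq r t.
apply: dP; last by rewrite lt_neqAle nrt.
by rewrite /= ler0_norm ?subr_le0// opprB ltrBlDl.
Unshelve. all: by end_near. Qed.
End TimeDerivative.

(** * Arrival times from differential inequalities *)

Section Reach.
Context (R : realType) (f : R -> R).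
Hypothesis f_cont : {within `[0, +oo[, continuous f}.

Let f_cont_itv a b : 0 <= a -> {within `[a, b], continuous f}.
Proof.
move=> a0; apply: continuous_subspaceW f_cont => t /=.
by rewrite !in_itv /= andbT => /andP[/(le_trans a0)].
Qed.

(** This barrier keeps [f] in the region where a differential inequality is available: a negative
    derivative is required only at instants where [f] is back at its starting value. *)
Lemma le_start (T t1 : R) : 0 <= t1 ->
  (forall t, t1 <= t -> t < T -> f t = f t1 ->
     exists2 d, time_derivative f t d & d < 0) ->
  forall t, t1 <= t <= T -> f t <= f t1.
Proof.
move=> t10 fd; apply: le_cst_forward => //; first exact: f_cont_itv.
move=> t t1t tT ft; have [d ftd d0] := fd t t1t tT ft.
by rewrite -ft; apply: time_derivative_right ftd => //; exact: le_trans t1t.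
Qed.

(** As long as [f] is positive, its square root has derivative at most [- k]. Staying positive up to
    the instant [T] at which the linear bound vanishes would contradict the mean value theorem on
    [[t1, T]]. *)
Lemma reach_zero (k C t1 : R) : 0 < k -> 0 <= t1 -> f t1 <= C ->
  (forall t, 0 <= t -> 0 <= f t) ->
  (forall t, 0 <= t -> 0 < f t <= C ->
     exists2 d, time_derivative f t d & d <= - (2 * k * Num.sqrt (f t))) ->
  exists ts, [/\ t1 <= ts, f ts = 0 & ts <= t1 + Num.sqrt (f t1) / k].
Proof.
move=> k0 t10 f1C f0 fd; apply: contrapT => /forallNP no.
pose T := t1 + Num.sqrt (f t1) / k.
have le1T : t1 <= T by rewrite lerDl divr_ge0 ?sqrtr_ge0 ?ltW.
have fpos t : t1 <= t <= T -> 0 < f t.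
  move=> /andP[t1t tT]; rewrite lt_neqAle f0 ?(le_trans t10)// andbT.
  by apply/eqP => ft; apply: (no t).
have f1 : 0 < f t1 by apply: fpos; rewrite lexx.
have lt1T : t1 < T by rewrite ltrDl divr_gt0 ?sqrtr_gt0.
have fle t : t1 <= t <= T -> f t <= C.
  move=> tT; apply: le_trans (f1C); apply: (@le_start T) => // s t1s sT fs.
  have [|d ftd dle] := fd s (le_trans t10 t1s); first by rewrite fs f1 f1C.
  exists d => //; apply: le_lt_trans dle _.
  by rewrite oppr_lt0 !mulr_gt0 ?sqrtr_gt0 ?fs.
have fdT t : t1 <= t <= T ->
    exists2 d, time_derivative f t d & d <= - (2 * k * Num.sqrt (f t)).
  move=> tT; apply: fd; last by rewrite fpos ?fle.
  by case/andP: tT => /(le_trans t10).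
(* The mean value theorem needs the derivative as a function, so one is chosen. The default 0 is
   never taken on [[t1, T]], by [fdT]. *)
pose df t := xget 0 [set d | time_derivative f t d /\
   d <= - (2 * k * Num.sqrt (f t))].
have dfP t : t1 <= t <= T -> time_derivative f t (df t) /\
    df t <= - (2 * k * Num.sqrt (f t)).
  move=> /fdT[d fd1 fd2].
  have : exists d, [set d | time_derivative f t d /\ d <= - (2 * k * Num.sqrt (f t))] d by exists d.
  by move=> /(xgetPex 0).
have [||c cT] := @MVT R (Num.sqrt \o f)
    (fun t => df t * (2 * Num.sqrt (f t))^-1) _ _ lt1T.
- move=> t; rewrite in_itv /= => /andP[t1t tT].
  have tT' : t1 <= t <= T by rewrite !ltW.
  have t0 : 0 < t := le_lt_trans t10 t1t.
  have ? := time_derivative_is_derive t0 (dfP t tT').1.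
  have ? := is_derive1_sqrt (fpos t tT').
  rewrite mulrC; exact: is_derive1_comp.
- apply: within_continuous_comp; last exact: f_cont_itv.
  by move=> y _; exact: sqrt_continuous.
have cT' : t1 <= c <= T by move: cT; rewrite in_itv /= => /andP[/ltW-> /ltW->].
have [_ dfc] := dfP c cT'; have s0 : 0 < Num.sqrt (f c) by rewrite sqrtr_gt0 fpos.
have le_k : df c * (2 * Num.sqrt (f c))^-1 <= - k.
  rewrite ler_pdivrMr ?mulr_gt0//; apply: le_trans dfc _.
  by rewrite le_eqVlt; apply/orP; left; apply/eqP; ring.
have fT : 0 < Num.sqrt (f T) by rewrite sqrtr_gt0 fpos// lexx ltW.
have Tt : k * (T - t1) = Num.sqrt (f t1) by rewrite /T addrC addKr mulrC divfK// gt_eqF.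
have Tt0 : 0 <= T - t1 by rewrite subr_ge0.
move=> /= E; have := ler_wpM2r Tt0 le_k; rewrite -E mulNr Tt; lra.
Qed.

(** The function ln (f / (D - f)) decreases at rate at least 2 D, and [f = D / 4] corresponds to the
    value - ln 3. The maximum with 0 covers a start at or below [D / 4], where the logarithmic bound
    is not positive. *)
Lemma reach_quarter (D : R) : 0 < D -> f 0 < D ->
  (forall t, 0 <= t -> 0 < f t < D ->
     exists2 d, time_derivative f t d & d <= - (2 * (f t * (D - f t)))) ->
  exists t1, [/\ 0 <= t1, f t1 <= D / 4 &
    t1 <= Num.max 0 (1 / (2 * D) * ln (3 * f 0 / (D - f 0)))].
Proof.
move=> D0 f0D fd; have [f0q|f0q] := leP (f 0) (D / 4).
  by exists 0; rewrite lexx le_max lexx.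
apply: contrapT => /forallNP no.
pose T := 1 / (2 * D) * ln (3 * f 0 / (D - f 0)).
(* This is [D / 4 < f 0] rewritten; it makes [T] positive, so that [[0, T]] is a proper interval. *)
have x1 : 1 < 3 * f 0 / (D - f 0) by rewrite ltr_pdivlMr; lra.
have T0 : 0 < T by rewrite mulr_gt0 ?ln_gt0// divr_gt0// mulr_gt0.
have fq t : 0 <= t <= T -> D / 4 < f t.
  move=> /andP[t0 tT]; rewrite ltNge; apply/negP => ft; apply: (no t).
  by split=> //; rewrite le_max tT orbT.
have fpos t : 0 <= t <= T -> 0 < f t by move=> /fq; apply: le_lt_trans; rewrite divr_ge0// ltW.
have fle t : 0 <= t <= T -> f t <= f 0.
  move=> tT; apply: (@le_start T) => // s s0 sT fs.
  have [|d ftd dle] := fd s s0; first by rewrite fs; apply/andP; split=> //; lra.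
  exists d => //; apply: le_lt_trans dle _.
  by rewrite oppr_lt0 !mulr_gt0// ?subr_gt0 fs//; lra.
have flt t : 0 <= t <= T -> f t < D by move=> /fle /le_lt_trans; apply.
have fdT t : 0 <= t <= T ->
    exists2 d, time_derivative f t d & d <= - (2 * (f t * (D - f t))).
  move=> tT; apply: fd; last by rewrite fpos ?flt.
  by case/andP: tT.
pose df t := xget 0 [set d | time_derivative f t d /\
   d <= - (2 * (f t * (D - f t)))].
have dfP t : 0 <= t <= T -> time_derivative f t (df t) /\
    df t <= - (2 * (f t * (D - f t))).
  move=> /fdT[d fd1 fd2].
  have : exists d, [set d | time_derivative f t d /\ d <= - (2 * (f t * (D - f t)))] d by exists d.
  by move=> /(xgetPex 0).
pose g t := D - f t.
have [||c cT] := @MVT R ((@ln R \o f) - (@ln R \o g))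
    (fun t => (f t)^-1 * df t - (g t)^-1 * (0 - df t)) _ _ T0.
- move=> t; rewrite in_itv /= => /andP[t0 tT].
  have tT' : 0 <= t <= T by rewrite !ltW.
  have ? := time_derivative_is_derive t0 (dfP t tT').1.
  have gt0 : 0 < g t by rewrite subr_gt0 flt.
  have ? := is_derive1_ln (fpos t tT').
  have ? := is_derive1_ln gt0.
  have ? : is_derive t 1 g (0 - df t) by exact: is_deriveB.
  by apply: is_deriveB; exact: is_derive1_comp.
- have gc : {within `[0, T], continuous g}.
    by apply: within_continuousB; [move=> x; exact: cvg_cst|exact: f_cont_itv].
  apply: within_continuousB; apply: within_continuous_comp => //.
  + move=> _ /set_mem[t /= tT <-]; apply: continuous_ln; apply: fpos.
    by move: tT; rewrite in_itv.
  + exact: f_cont_itv.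
  + move=> _ /set_mem[t /= tT <-]; apply: continuous_ln; rewrite subr_gt0; apply: flt.
    by move: tT; rewrite in_itv.
have cT' : 0 <= c <= T by move: cT; rewrite in_itv /= => /andP[/ltW-> /ltW->].
have [_ dfc] := dfP c cT'; have fc0 := fpos c cT'; have gc0 := flt c cT'.
have {dfc}le_D : (f c)^-1 * df c - (g c)^-1 * (0 - df c) <= - (2 * D).
  rewrite (_ : _ - _ = D * (df c / (f c * (D - f c)))); last first.
    by rewrite /g; field; rewrite !gt_eqF ?subr_gt0.
  rewrite (_ : - (2 * D) = D * - 2); last by ring.
  rewrite ler_pM2l// ler_pdivrMr ?mulr_gt0 ?subr_gt0//.
  by apply: le_trans dfc _; rewrite mulNr.
have T0' := ltW T0.
have TT : 0 <= T <= T by rewrite T0' lexx.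
have fTq := fq T TT; have fT0 := fpos T TT; have fTD := flt T TT.
have := ler_wpM2r (_ : 0 <= T - 0) le_D; rewrite subr0 => /(_ T0') le_E E.
move: le_E; rewrite -E leNgt => /negP; apply.
rewrite -[X in _ < X]/(ln (f T) - ln (D - f T) - (ln (f 0) - ln (D - f 0))).
have ET : 2 * D * T = ln (3 : R) + ln (f 0) - ln (D - f 0).
  rewrite /T mulrA mulrA mulr1 divff ?mul1r ?mulf_neq0 ?gt_eqF//.
  by rewrite ln_div ?lnM ?posrE//; lra.
rewrite mulNr ET.
(* Since [D / 4 < f T], the logarithm of the ratio at [T] is still above - ln 3, against the
   decrease accumulated over [[0, T]]. *)
have : ln (D - f T) < ln (3 * f T) by rewrite ltr_ln ?posrE; lra.
by rewrite lnM ?posrE//; lra.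
Qed.
End Reach.

(** * Moment inequalities for a distribution on a gapped spectrum *)

Section FiniteDistribution.
Context (R : realType) (m : nat) (E : 'I_m.+2 -> R) (p : 'I_m.+2 -> R).
Let D := E 1 - E 0.
Hypothesis D_gt0 : 0 < D.
Hypothesis gapE : forall k, k != 0 -> E 1 <= E k.
Hypothesis p_ge0 : forall k, 0 <= p k.
Hypothesis p_sum1 : \sum_k p k = 1.
Let mean := \sum_k E k * p k.
Let a := mean - E 0.
Let mu j := \sum_k (E k - mean) ^+ j * p k.
Let m2 := \sum_k (E k - E 0) ^+ 2 * p k.
Let m3 := \sum_k (E k - E 0) ^+ 3 * p k.

Let aE : a = \sum_k (E k - E 0) * p k.
Proof.
rewrite /a /mean; under [RHS]eq_bigr do rewrite mulrBl.
by rewrite sumrB -mulr_sumr p_sum1 mulr1.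
Qed.

Lemma mu2E : mu 2 = m2 - a ^+ 2.
Proof.
transitivity (m2 - 2 * a * (\sum_k (E k - E 0) * p k) + a ^+ 2 * \sum_k p k).
  rewrite /mu /m2 !mulr_sumr -sumrB -big_split; apply: eq_bigr => k _ /=.
  by rewrite /a; ring.
by rewrite -aE p_sum1; ring.
Qed.

Lemma mu3E : mu 3 = m3 - 3 * a * m2 + 2 * a ^+ 3.
Proof.
transitivity (m3 - 3 * a * m2 + 3 * a ^+ 2 * (\sum_k (E k - E 0) * p k)
   - a ^+ 3 * \sum_k p k).
  rewrite /mu /m2 /m3 !mulr_sumr -!sumrB -!big_split -sumrB.
  by apply: eq_bigr => k _ /=; rewrite /a; ring.
by rewrite -aE p_sum1; ring.
Qed.

Let x_ge0 k : 0 <= E k - E 0.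
Proof.
have [->|/gapE] := eqVneq k 0; first by rewrite subrr.
by have := D_gt0; rewrite /D; lra.
Qed.

Lemma excess_ge0 : 0 <= a.
Proof. by rewrite aE; apply: sumr_ge0 => k _; rewrite mulr_ge0. Qed.

(** Each excess x = [E k - E 0] is either 0 or at least [D], so D x <= x^2 holds term by term. *)
Lemma gap_m2 : D * a <= m2.
Proof.
rewrite aE /m2 mulr_sumr; apply: ler_sum => k _; rewrite mulrA ler_wpM2r//.
have [->|/gapE kE] := eqVneq k 0; first by rewrite subrr mulr0 expr0n.
by rewrite expr2 ler_wpM2r ?x_ge0 // /D lerD2r; exact: kE.
Qed.

(** Cauchy-Schwarz for the functions 1 and x under the weights x p, where x = [E k - E 0]: the sum
    of x (x a - m2)^2 p is nonnegative and equals a (a m3 - m2^2). *)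
Lemma cauchy_m3 : 0 < a -> m2 ^+ 2 <= m3 * a.
Proof.
move=> a0; rewrite -subr_ge0 -(pmulr_rge0 _ a0).
have : 0 <= \sum_k (E k - E 0) * ((E k - E 0) * a - m2) ^+ 2 * p k.
  by apply: sumr_ge0 => k _; rewrite mulr_ge0// mulr_ge0// sqr_ge0.
(* The variable [b] stands for the [m2] inside the square, which must stay folded while the other
   moments are unfolded. *)
have -> : forall b, \sum_k (E k - E 0) * ((E k - E 0) * a - b) ^+ 2 * p k =
   a ^+ 2 * m3 - 2 * a * b * m2 + b ^+ 2 * \sum_k (E k - E 0) * p k.
  move=> b; rewrite /m3 /m2 !mulr_sumr -sumrB -big_split.
  by apply: eq_bigr => k _ /=; ring.
rewrite -aE => /le_trans; apply; rewrite le_eqVlt; apply/orP; left.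
by apply/eqP; ring.
Qed.

Lemma mu2_ge : a * (D - a) <= mu 2.
Proof. by rewrite mu2E; have := gap_m2; lra. Qed.

Lemma rate_ge : 0 < a <= D / 4 ->
  (5 / 16) ^+ 2 * D ^+ 3 * a <= 4 * mu 2 ^+ 2 + mu 3 ^+ 2 / mu 2.
Proof.
move=> /andP[a0 aD].
have := gap_m2; have := cauchy_m3 a0; rewrite mu2E mu3E.
have -> : m2 = a * (m2 / a) by field; rewrite gt_eqF.
(* With m2 = a w, replacing m3 by its lower bound a w^2 turns the right-hand
   side into a (w - a) w^2, which increases with w >= D. *)
set w := m2 / a; move: m3 => c; rewrite exprMn => ca Dw.
have {}ca : a * w ^+ 2 <= c.
  rewrite -(ler_pM2r a0); apply: le_trans ca.
  by rewrite le_eqVlt; apply/orP; left; apply/eqP; ring.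
have {}Dw : D <= w by rewrite -(ler_pM2r a0) [w * a]mulrC.
have D0 := D_gt0.
have mu_gt0 : 0 < a * w - a ^+ 2.
  by rewrite expr2 -mulrBr mulr_gt0//; lra.
have c_ge : a * (w - a) * (w - 2 * a) <= c - 3 * a * (a * w) + 2 * a ^+ 3.
  by lra.
(* The lower bound for the third moment may be squared only because it is nonnegative; this uses 4 a
   <= D <= w. *)
have y_ge0 : 0 <= a * (w - a) * (w - 2 * a) by rewrite !mulr_ge0//; lra.
have sq : a * (w - a) * (w - 2 * a) ^+ 2 <=
    (c - 3 * a * (a * w) + 2 * a ^+ 3) ^+ 2 / (a * w - a ^+ 2).
  rewrite ler_pdivlMr//; apply: le_trans (_ : (a * (w - a) * (w - 2 * a)) ^+ 2 <= _).
    by rewrite le_eqVlt; apply/orP; left; apply/eqP; ring.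
  by rewrite lerXn2r ?nnegrE ?(le_trans y_ge0).
(* The variance is a (w - a), and (w - 2 a)^2 + 4 a (w - a) = w^2 merges the two terms. *)
apply: le_trans (_ : a * (w - a) * w ^+ 2 <= _); last by lra.
have w0 : 0 < w by lra.
(* From [D <= w] and [a <= D / 4] comes w - a >= 3 D / 4. The factor 3 / 4 leaves ample room above
   (5 / 16)^2. *)
apply: le_trans (_ : a * (3 / 4 * D) * D ^+ 2 <= _).
  have : 0 <= a * D ^+ 3 by rewrite mulr_ge0 ?exprn_ge0// ltW.
  by lra.
rewrite -!(mulrA a) ler_pM2l// ler_pM ?sqr_ge0//; [lra|lra|].
by rewrite lerXn2r ?nnegrE// ltW.
Qed.
End FiniteDistribution.

(** * Closed form of the decay rate *)

Lemma powR_3_2 (R : realType) (x : R) : 0 < x -> x `^ (3 / 2) = x * Num.sqrt x.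
Proof.
move=> x0; rewrite (_ : 3 / 2 = 1 + 2^-1); last by field.
rewrite powRD; last by rewrite gt_eqF// implybT.
by rewrite powRr1 ?ltW// powR12_sqrt ?ltW.
Qed.

(** By the double-angle formulas the left-hand side is cos x + k sin x at x = [atan k]. There sin x
    = k cos x, and cos x is the inverse of the square root of 1 + k^2. *)
Lemma half_atan_rate (R : realType) (k : R) :
  let c := cos (atan k / 2) in let s := sin (atan k / 2) in
  c ^+ 2 - s ^+ 2 + 2 * k * (c * s) = Num.sqrt (1 + k ^+ 2).
Proof.
move=> c s.
have two : atan k = atan k / 2 + atan k / 2 by field.
have cc : c ^+ 2 - s ^+ 2 = cos (atan k) by rewrite [in RHS]two cosD -/c -/s; ring.
have ss : 2 * (c * s) = sin (atan k) by rewrite [in RHS]two sinD -/c -/s; ring.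
have k0 : 0 < 1 + k ^+ 2 by have := sqr_ge0 k; lra.
have r0 : Num.sqrt (1 + k ^+ 2) != 0 by rewrite gt_eqF// sqrtr_gt0.
have ct : cos (atan k) = (Num.sqrt (1 + k ^+ 2))^-1 by rewrite cos_atan.
have st : sin (atan k) = k * cos (atan k).
  have c0 : cos (atan k) != 0 by rewrite ct invr_eq0.
  by rewrite -{2}(atanK k) /tan divfK.
rewrite cc [2 * k]mulrC -mulrA ss st ct.
rewrite (_ : _ + _ = (1 + k ^+ 2) / Num.sqrt (1 + k ^+ 2)); last by ring.
by rewrite -{1}(sqr_sqrtr (ltW k0)) expr2 mulfK.
Qed.

Lemma aite_rate (R : realType) (M2 M3 : R) : 0 < M2 ->
  let k := M3 / (M2 `^ (3 / 2)) / 2 in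
  let r := (Num.sqrt M2)^-1 in
  let c := cos (atan k / 2) in let s := sin (atan k / 2) in
  2 * (c ^+ 2 * M2 + c * s * r * M3 - s ^+ 2 * r ^+ 2 * M2 ^+ 2) =
  Num.sqrt (4 * M2 ^+ 2 + M3 ^+ 2 / M2).
Proof.
move=> M0 k r c s.
have q0 : 0 < Num.sqrt M2 by rewrite sqrtr_gt0.
have qq : M2 = Num.sqrt M2 ^+ 2 by rewrite sqr_sqrtr// ltW.
have pw : M2 `^ (3 / 2) = Num.sqrt M2 ^+ 3.
  by rewrite powR_3_2// {1}qq -exprSr.
have kE : k = M3 / (2 * Num.sqrt M2 ^+ 3).
  by rewrite /k pw; field; rewrite gt_eqF.
have rE : r = (Num.sqrt M2)^-1 by [].
(* With q the square root of [M2] as an independent variable, all quantities are rational in q and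
   [field] applies. *)
clearbody r k; move: (Num.sqrt M2) q0 qq kE rE {pw} => q q0 qq kE rE.
have -> : 2 * (c ^+ 2 * M2 + c * s * r * M3 - s ^+ 2 * r ^+ 2 * M2 ^+ 2) =
   2 * M2 * (c ^+ 2 - s ^+ 2 + 2 * k * (c * s)).
  by rewrite qq rE kE; field; rewrite gt_eqF.
rewrite half_atan_rate -[2 * M2]ger0_norm; last by lra.
rewrite -sqrtr_sqr -sqrtrM ?sqr_ge0//; congr Num.sqrt.
by rewrite qq kE; field; rewrite gt_eqF.
Qed.

(** * Populations and energy along the flow *)

Lemma cvg_sqnormc_braket (R : realType) (m : nat) (T : Type) (F : set_system T)
    (w : 'cV[R[i]]_m.+1) (f : T -> 'cV[R[i]]_m.+1) v :
  Filter F -> f @ F --> v ->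
  (fun x => sqnormc (braket w (f x))) @ F --> sqnormc (braket w v).
Proof.
move=> FF fv; apply: cvgD.
  have fre : (fun x => complex.Re (braket w (f x))) @ F -->
      complex.Re (braket w v).
    by apply: cvg_Re; exact: cvg_braket.
  by rewrite expr2; apply: cvgM.
have fim : (fun x => complex.Im (braket w (f x))) @ F -->
    complex.Im (braket w v).
  rewrite Im_braket; under eq_fun do rewrite Im_braket.
  by apply: cvg_Re; exact: cvg_braket.
by rewrite expr2; apply: cvgM.
Qed.

(** A real factor [g] acts alike on the real and imaginary parts of the amplitude, so the
    derivatives of their squares add up to a multiple of the squared modulus. *)
Lemma sqnormc_derivative (R : realType) (m : nat) (w : 'cV[R[i]]_m.+1)
    psi t v (g : R) :
  ket_derivative psi t v -> braket w v = g%:C * braket w (psi t) ->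
  time_derivative (fun s => sqnormc (braket w (psi s))) t
    (2 * g * sqnormc (braket w (psi t))).
Proof.
move=> dpsi gw.
have dre := time_derivative_sqr (ket_derivative_Re (w := w) dpsi).
have dim := time_derivative_sqr (ket_derivative_Re (w := 'i%C *: w) dpsi).
have gre : complex.Re (braket w v) = g * complex.Re (braket w (psi t)).
  by rewrite gw; case: (braket w (psi t)) => x y /=; rewrite mul0r subr0.
have gim : complex.Im (braket w v) = g * complex.Im (braket w (psi t)).
  by rewrite gw; case: (braket w (psi t)) => x y /=; rewrite mul0r addr0.
have := time_derivativeD dre dim.
rewrite -Im_braket gre -Im_braket gim.
rewrite (_ : _ + _ = 2 * g * sqnormc (braket w (psi t))); last first.
  by rewrite /sqnormc; ring.
rewrite (_ : (fun s => _) = fun s => sqnormc (braket w (psi s))) //.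
by apply/funext => s; rewrite /sqnormc Im_braket.
Qed.

Section EnergyDecay.
Context (R : realType) (m : nat) (e : 'I_m.+1 -> 'cV[R[i]]_m.+1).
Context (E : 'I_m.+1 -> R).
Hypothesis eO : orthonormal_kets e.
Let H := spectral_sum E e.

Lemma expect_continuous (psi : R -> 'cV[R[i]]_m.+1) (A : set R) (c : R) :
  {within A, continuous psi} ->
  {within A, continuous (fun t => expect H (psi t) - c)}.
Proof.
move=> /subspace_continuousP psic; apply/subspace_continuousP => t At.
have -> : (fun t => expect H (psi t) - c) =
    fun t => \sum_k E k * sqnormc (braket (e k) (psi t)) - c.
  by apply/funext => s; rewrite (expect_spectral eO).
apply: cvgB; last exact: cvg_cst.
apply: (@cvg_big _ _ +%R 0 xpredT add_continuous) => k _.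
apply: cvgMl_tmp; apply: cvg_sqnormc_braket; exact: psic.
Qed.

Lemma expect_derivative (psi : R -> 'cV[R[i]]_m.+1) (t c : R) :
  let M j := moment H j (psi t) in
  braket (psi t) (psi t) = 1 -> 0 < M 2 ->
  ket_derivative psi t (aite_field H (psi t)) ->
  time_derivative (fun s => expect H (psi s) - c) t
    (- Num.sqrt (4 * M 2 ^+ 2 + M 3 ^+ 2 / M 2)).
Proof.
move=> M psi1 M2pos dpsi.
pose a := expect H (psi t); pose h k := E k - a.
pose p k := sqnormc (braket (e k) (psi t)).
pose r := (Num.sqrt (M 2))^-1.
pose c' := cos (aite_angle H (psi t)); pose s' := sin (aite_angle H (psi t)).
pose g k := - ((c' + s' * r * h k) * (c' * h k - s' * r * M 2)).
have dp k : time_derivative (fun s => E k * sqnormc (braket (e k) (psi s))) t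
    (E k * (2 * g k * p k)).
  apply: time_derivativeZ; apply: sqnormc_derivative dpsi _.
  by rewrite (braket_aite_field eO _ _ psi1).
have := time_derivativeD (time_derivative_sum (r := index_enum _) dp)
   (time_derivative_cst (- c) t).
rewrite addr0.
have p1 : \sum_k p k = 1.
  by apply: (@complexI R); rewrite -(braket_sqnorm eO) psi1.
have hp0 : \sum_k h k * p k = 0.
  under eq_bigr do rewrite mulrBl.
  by rewrite sumrB -mulr_sumr p1 mulr1 /a /H (expect_spectral eO) subrr.
have M2E : M 2 = \sum_k h k ^+ 2 * p k by exact: moment_spectral.
have M3E : M 3 = \sum_k h k ^+ 3 * p k by exact: moment_spectral.
have -> : \sum_k E k * (2 * g k * p k) =
    - (2 * (c' ^+ 2 * M 2 + c' * s' * r * M 3 - s' ^+ 2 * r ^+ 2 * M 2 ^+ 2)).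
  (* Writing [E k] as [h k + a] and sorting by powers of [h k] leaves centred moments of orders 3 to
     0. The first moment vanishes, and the remaining terms in [a] cancel. *)
  transitivity (- 2 * (c' * s' * r * (\sum_k h k ^+ 3 * p k)
     + (c' ^+ 2 - s' ^+ 2 * r ^+ 2 * M 2 + a * c' * s' * r)
        * (\sum_k h k ^+ 2 * p k)
     + (a * (c' ^+ 2 - s' ^+ 2 * r ^+ 2 * M 2) - c' * s' * r * M 2)
        * (\sum_k h k * p k)
     - a * c' * s' * r * M 2 * \sum_k p k)).
    rewrite !mulr_sumr -!big_split -sumrB mulr_sumr.
    apply: eq_bigr => k _ /=; rewrite /g /h.
    by move: (M 2) (c') (s') (r) (a) (p k) => *; ring.
  rewrite hp0 p1 -M2E -M3E.
  by move: (M 2) (M 3) (c') (s') (r) (a) => *; ring.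
rewrite (aite_rate _ M2pos).
rewrite (_ : (fun s => _) = fun s => expect H (psi s) - c) //.
by apply/funext => s; rewrite /H (expect_spectral eO).
Qed.
End EnergyDecay.

(** The entry time is compared with a maximum with 0 because the logarithm is not positive when the
    trajectory starts in the basin. *)
Theorem theorem2 (R : realType) (n : nat)
    (E : 'I_n.+2 -> R) (e : 'I_n.+2 -> 'cV[R[i]]_n.+2)
    (psi : R -> 'cV[R[i]]_n.+2) :
  let H := spectral_sum E e in
  let E_GS := E 0 in
  let Delta := E 1 - E_GS in
  let mu k t := moment H k (psi t) in
  let eps t := expect H (psi t) - E_GS in
  orthonormal_kets e ->
  0 < Delta ->
  (forall k : 'I_n.+2, k != 0 -> E 1 <= E k) ->
  aite_trajectory H E_GS psi ->
  [/\ (forall t : R, 0 <= t -> 0 < mu 2%N t ->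
         time_derivative eps t
           (- Num.sqrt (4 * mu 2%N t ^+ 2 + mu 3%N t ^+ 2 / mu 2%N t))),
      (forall t : R, 0 <= t -> 0 < eps t <= Delta / 4 ->
         exists2 d, time_derivative eps t d &
           d <= - (5 / 16 * (Delta `^ (3 / 2)) * Num.sqrt (eps t))),
      (forall t1 : R, 0 <= t1 -> eps t1 <= Delta / 4 ->
         exists ts : R, [/\ t1 <= ts, eps ts = 0,
           ts <= t1 + 32 / 5 * (1 / Delta) * Num.sqrt (eps t1 / Delta) &
           t1 + 32 / 5 * (1 / Delta) * Num.sqrt (eps t1 / Delta)
             <= t1 + 16 / (5 * Delta)]) &
      (eps 0 < Delta ->
         exists t1 : R, [/\ 0 <= t1, eps t1 <= Delta / 4 &
           t1 <= Num.max 0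
                   (1 / (2 * Delta) * ln (3 * eps 0 / (Delta - eps 0)))])].
Proof.
move=> H E_GS Delta mu eps eO D0 gapE [psi1 psic flow _].
pose p t k := sqnormc (braket (e k) (psi t)).
have p_ge0 t k : 0 <= p t k by rewrite addr_ge0// sqr_ge0.
have p1 t : 0 <= t -> \sum_k p t k = 1.
  by move=> t0; apply: (@complexI R); rewrite -(braket_sqnorm eO) psi1.
have epsE t : eps t = \sum_k E k * p t k - E 0.
  by rewrite /eps (expect_spectral eO).
have muE j t : mu j t = \sum_k (E k - \sum_k E k * p t k) ^+ j * p t k.
  by rewrite /mu (moment_spectral eO) (expect_spectral eO).
have eps_ge0 t : 0 <= t -> 0 <= eps t.
  by move=> t0; rewrite epsE; apply: excess_ge0 => //; exact: p1.
have mu2_lb t : 0 <= t -> eps t * (Delta - eps t) <= mu 2 t.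
  by move=> t0; rewrite epsE muE; apply: mu2_ge => //; exact: p1.
have rate t : 0 <= t -> 0 < mu 2%N t -> time_derivative eps t
    (- Num.sqrt (4 * mu 2%N t ^+ 2 + mu 3%N t ^+ 2 / mu 2%N t)).
  by move=> t0 mu0; apply: expect_derivative => //; [exact: psi1|exact: flow].
(* Strictly between the two lowest levels the state is not an eigenvector, so the flow equation is
   in force. *)
have mu2_gt0 t : 0 <= t -> 0 < eps t < Delta -> 0 < mu 2 t.
  move=> t0 /andP[e0 eD]; apply: lt_le_trans (mu2_lb t t0).
  by rewrite mulr_gt0// subr_gt0.
have epsc : {within `[0, +oo[%classic, continuous eps} by exact: expect_continuous.
have basin t : 0 <= t -> 0 < eps t <= Delta / 4 ->
    exists2 d, time_derivative eps t d &
      d <= - (5 / 16 * (Delta `^ (3 / 2)) * Num.sqrt (eps t)).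
  move=> t0 et; have /andP[e0 eq] := et.
  have mu0 : 0 < mu 2%N t by apply: mu2_gt0 => //; rewrite e0; lra.
  exists (- Num.sqrt (4 * mu 2%N t ^+ 2 + mu 3%N t ^+ 2 / mu 2%N t)).
    exact: rate.
  rewrite lerN2 powR_3_2//.
  have x0 : 0 <= 5 / 16 * (Delta * Num.sqrt Delta) * Num.sqrt (eps t).
    by rewrite !mulr_ge0 ?sqrtr_ge0// ltW.
  rewrite -(ger0_norm x0) -sqrtr_sqr ler_wsqrtr//.
  rewrite !exprMn !sqr_sqrtr ?(ltW D0) ?(ltW e0)//.
  have := @rate_ge R n E (p t) D0 gapE (p_ge0 t) (p1 t t0).
  rewrite -epsE -!muE => /(_ et); apply: le_trans.
  by rewrite le_eqVlt; apply/orP; left; apply/eqP; rewrite -/E_GS -/Delta; field.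
split=> //.
- move=> t1 t10 et1.
  (* Half of the basin constant 5 / 16, since the derivative of the square root of [eps] is that of
     [eps] divided by twice this root. *)
  have k0 : 0 < 5 / 32 * Delta `^ (3 / 2) by rewrite mulr_gt0 ?powR_gt0.
  have [|ts [t1ts ets tsle]] := reach_zero epsc k0 t10 et1 eps_ge0.
    move=> t t0 /(basin t t0)[d ed dle]; exists d => //; apply: le_trans dle _.
    by rewrite lerN2 le_eqVlt; apply/orP; left; apply/eqP; field.
  have timeE : 32 / 5 * (1 / Delta) * Num.sqrt (eps t1 / Delta) =
      Num.sqrt (eps t1) / (5 / 32 * Delta `^ (3 / 2)).
    rewrite powR_3_2// sqrtrM ?eps_ge0// sqrtrV ?ltW//.
    by field; rewrite !gt_eqF ?sqrtr_gt0.
  exists ts; split=> //; first by rewrite timeE.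
  rewrite lerD2l.
  have half : Num.sqrt (eps t1 / Delta) <= 2^-1.
    rewrite -[leRHS]ger0_norm ?invr_ge0// -sqrtr_sqr ler_wsqrtr//.
    rewrite ler_pdivrMr// (_ : 2^-1 ^+ 2 * Delta = Delta / 4) //.
    by move: (Delta) => *; field.
  apply: le_trans (ler_wpM2l _ half) _; first by rewrite mulr_ge0// divr_ge0// ltW.
  by rewrite le_eqVlt; apply/orP; left; apply/eqP; field; rewrite gt_eqF.
- move=> e0D; apply: reach_quarter => // t t0 et.
  exists (- Num.sqrt (4 * mu 2%N t ^+ 2 + mu 3%N t ^+ 2 / mu 2%N t)).
    by apply: rate => //; exact: mu2_gt0.
  have mu0 := mu2_gt0 t t0 et.
  (* Outside the basin the skewness term under the root is dropped, and the variance bound alone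
     gives the logistic inequality. *)
  rewrite lerN2; apply: le_trans (_ : 2 * mu 2 t <= _).
    by rewrite ler_pM2l// mu2_lb.
  have x0 : 0 <= 2 * mu 2 t by rewrite mulr_ge0// ltW.
  rewrite -(ger0_norm x0) -sqrtr_sqr ler_wsqrtr//.
  have four : 2 ^+ 2 = 4 :> R by ring.
  by rewrite exprMn four lerDl divr_ge0 ?sqr_ge0 ?ltW.
Qed.
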